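(* If $f,g \in o_F [\![X]\!]^{\psi=0}$ and $m,\ell \geq 0$, then $c_{f,m}(T) \cdot c_{g,\ell}(T) \in \operatorname{Pol}(o_F [\![X]\!]^{\psi=0})+\pi\cdot\operatorname{Int}$, i.e. the image of $c_{f,m}c_{g,\ell}$ in $\operatorname{Int}/\pi\operatorname{Int}$ lies in the image of $\operatorname{Pol}(o_F [\![X]\!]^{\psi=0})$.
   Context: $F$ is a finite extension of $\mathbf{Q}_p$ with ring of integers $o_F$ and uniformizer $\pi$. $\operatorname{LT}$ is the Lubin–Tate formal group over $o_F$ attached to $\pi$ with a chosen coordinate $X$, formal addition law $\oplus$ and endomorphisms $[a](X)\in o_F[\![X]\!]$. $\operatorname{Int}=\{P\in F[T]:P(o_F)\subset o_F\}$. For $f\in o_F[\![X]\!]$, $c_{f,n}\in\operatorname{Int}$ are the polynomials with $f([a](X))=\sum_{n\ge0}c_{f,n}(a)X^n$ for all $a\in o_F$; for $M\subset o_F[\![X]\!]$, $\operatorname{Pol}(M)$ is the $o_F$-submodule of $\operatorname{Int}$ generated by the $c_{f,n}$, $f\in M$, $n\ge0$. $\phi(f)(X)=f([\pi](X))$, $\psi$ is defined by $\phi(\psi(f))=\pi^{-1}\operatorname{Tr}_{o_F[\![X]\!]/\phi(o_F[\![X]\!])}(f)$, and $o_F[\![X]\!]^{\psi=0}$ is its kernel. *)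

(* Defs.v *)
From HB Require Import structures.
From mathcomp Require Import all_boot all_order all_algebra all_field.
From mathcomp Require Import boolp.
From mathcomp Require Import mpoly.

Set Implicit Arguments.
Unset Strict Implicit.
Unset Printing Implicit Defensive.

Import GRing.Theory.
Local Open Scope ring_scope.

(* Z_p is the inverse limit of the rings Z / p^n Z: the residue class of x
   modulo p^n is represented by the integer x n in [0, p^n). *)

Definition padic_compat (p : nat) (x : nat -> int) : Prop :=
  forall n, x n = (x n.+1 %% (p ^ n)%N%:Z)%Z.

(* The primality proof is a parameter so that the ring instances, which depend
   on it, can be inferred from the type. *)
Record padic_int (p : nat) (pr : prime p) := PadicInt {
  padic_seq :> nat -> int;
  padic_seqP : padic_compat p padic_seq }.

Section PadicIntegers.
Variables (p : nat) (pr : prime p).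
Local Notation padic_int := (padic_int pr).
Local Notation PadicInt := (@PadicInt p pr _).

HB.instance Definition _ := gen_eqMixin padic_int.
HB.instance Definition _ := gen_choiceMixin padic_int.

Implicit Types x y z : padic_int.
Local Notation "''P' n" := ((p ^ n)%N%:Z) (at level 8, n at level 2).

Lemma padic_eq x y : (forall n, x n = y n) -> x = y.
Proof.
case: x y => [x hx] [y hy] /= /funext E; rewrite E in hx *.
by congr PadicInt; exact: Prop_irrelevance.
Qed.

Lemma padic_modS (a : int) n : ((a %% 'P n.+1)%Z = a %[mod 'P n])%Z.
Proof.
have -> : a = (a %/ 'P n.+1)%Z * 'P n.+1 + (a %% 'P n.+1)%Z.
  exact: divz_eq.
rewrite modzMDl modz_mod.
by rewrite expnS PoszM [in RHS]mulrA modzMDl.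
Qed.

Lemma padic_mod x n : (x n %% 'P n)%Z = x n.
Proof. by rewrite (padic_seqP x n) modz_mod. Qed.

Lemma padic_ofP (f : nat -> int) :
  (forall n, f n.+1 = f n %[mod 'P n])%Z ->
  padic_compat p (fun n => (f n %% 'P n)%Z).
Proof. by move=> hf n /=; rewrite padic_modS hf. Qed.

Lemma padic_step x n : (x n.+1 = x n %[mod 'P n])%Z.
Proof. by rewrite (padic_seqP x n) modz_mod. Qed.

Definition padic_const (a : int) : padic_int :=
  PadicInt (padic_ofP (f := fun _ => a) (fun n => erefl)).

Lemma padic_add_subproof x y n :
  (x n.+1 + y n.+1 = x n + y n %[mod 'P n])%Z.
Proof. by rewrite -modzDm !padic_step modzDm. Qed.
Definition padic_add x y : padic_int :=
  PadicInt (padic_ofP (f := fun n => x n + y n) (padic_add_subproof x y)).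

Lemma padic_opp_subproof x n : (- x n.+1 = - x n %[mod 'P n])%Z.
Proof. by rewrite -modzNm padic_step modzNm. Qed.
Definition padic_opp x : padic_int :=
  PadicInt (padic_ofP (f := fun n => - x n) (padic_opp_subproof x)).

Lemma padic_mul_subproof x y n :
  (x n.+1 * y n.+1 = x n * y n %[mod 'P n])%Z.
Proof. by rewrite -modzMm !padic_step modzMm. Qed.
Definition padic_mul x y : padic_int :=
  PadicInt (padic_ofP (f := fun n => x n * y n) (padic_mul_subproof x y)).

Lemma padic_addA : associative padic_add.
Proof. by move=> x y z; apply: padic_eq => n /=; rewrite modzDml modzDmr addrA. Qed.
Lemma padic_addC : commutative padic_add.
Proof. by move=> x y; apply: padic_eq => n /=; rewrite addrC. Qed.
Lemma padic_add0 : left_id (padic_const 0) padic_add.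
Proof. by move=> x; apply: padic_eq => n /=; rewrite modzDml add0r padic_mod. Qed.
Lemma padic_addN : left_inverse (padic_const 0) padic_opp padic_add.
Proof. by move=> x; apply: padic_eq => n /=; rewrite modzDml addNr. Qed.
HB.instance Definition _ := GRing.isZmodule.Build padic_int
  padic_addA padic_addC padic_add0 padic_addN.

Lemma padic_mulA : associative padic_mul.
Proof. by move=> x y z; apply: padic_eq => n /=; rewrite modzMml modzMmr mulrA. Qed.
Lemma padic_mulC : commutative padic_mul.
Proof. by move=> x y; apply: padic_eq => n /=; rewrite mulrC. Qed.
Lemma padic_mul1 : left_id (padic_const 1) padic_mul.
Proof. by move=> x; apply: padic_eq => n /=; rewrite modzMml mul1r padic_mod. Qed.
Lemma padic_mulD : left_distributive padic_mul padic_add.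
Proof.
by move=> x y z; apply: padic_eq => n /=; rewrite modzMml mulrDl modzDm.
Qed.
Lemma padic_neq0 : padic_const 1 != 0.
Proof.
apply/eqP => /(congr1 (fun x : padic_int => x 1%N)) /=.
by rewrite expn1 mod0z modz_small //= ltz_nat prime_gt1.
Qed.
HB.instance Definition _ := GRing.Zmodule_isComNzRing.Build padic_int
  padic_mulA padic_mulC padic_mul1 padic_mulD padic_neq0.

Definition padic_unit : {pred padic_int} := fun x => `[< exists y, y * x = 1 >].
Definition padic_inv x : padic_int :=
  if pselect (exists y, y * x = 1) is left h then projT1 (cid h) else x.

Lemma padic_mulV : {in padic_unit, left_inverse 1 padic_inv *%R}.
Proof.
move=> x /asboolP h; rewrite /padic_inv; case: pselect => // h'.
exact: (projT2 (cid h')).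
Qed.
Lemma padic_unitPl x y : y * x = 1 -> padic_unit x.
Proof. by move=> h; apply/asboolP; exists y. Qed.
Lemma padic_invout : {in [predC padic_unit], padic_inv =1 id}.
Proof.
move=> x /negP h; rewrite /padic_inv; case: pselect => // h'.
by case: h; apply/asboolP.
Qed.
HB.instance Definition _ := GRing.ComNzRing_hasMulInverse.Build padic_int
  padic_mulV padic_unitPl padic_invout.

Lemma padic_modD x n m : (x (n + m)%N %% 'P n)%Z = x n.
Proof.
elim: m => [|m IH]; first by rewrite addn0 padic_mod.
rewrite addnS -IH (padic_seqP x (n + m)).
have d : ('P n %| 'P (n + m))%Z by rewrite expnD PoszM dvdz_mulr.
have [k ->] := dvdzP d.
set a := x (n + m).+1.
by rewrite {1}(divz_eq a (k * 'P n)) mulrA modzMDl.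
Qed.

Lemma padic_logn x n m : x n != 0 -> (x (n + m)%N != 0) &&
  (logn p `|x (n + m)%N| < n)%N.
Proof.
move=> xn0; have := padic_modD x n m; move: (x (n + m)%N) => a ha.
have nd : ~~ ('P n %| a)%Z by apply: contra xn0 => /dvdz_mod0P; rewrite ha => ->.
have a0 : a != 0 by apply: contraNneq nd => ->; rewrite dvdz0.
rewrite a0 /=; rewrite ltnNge; apply: contra nd => h.
by rewrite dvdzE /= pfactor_dvdn // absz_gt0.
Qed.

Lemma padic_idomain x y : x * y = 0 -> (x == 0) || (y == 0).
Proof.
have nz z : z != 0 -> exists n, z n != 0.
  move=> z0; apply: contrapT => /forallNP h; case/eqP: z0.
  by apply: padic_eq => n; rewrite /= mod0z; apply/eqP/negPn/negP/h.
move=> xy0; apply/norP => -[/nz[n xn] /nz[m ym]].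
have /andP[x0 lx] := padic_logn m xn.
have /andP[y0 ly] := padic_logn n ym; rewrite addnC in y0 ly.
have /= := congr1 (fun z : padic_int => z (n + m)%N) xy0.
rewrite mod0z => /dvdz_mod0P; rewrite dvdzE abszM /=.
rewrite pfactor_dvdn ?muln_gt0 ?absz_gt0 ?x0 // lognM ?absz_gt0 //.
by rewrite leqNgt -addSn leq_add // ltnW.
Qed.
HB.instance Definition _ :=
  GRing.ComUnitRing_isIntegral.Build padic_int padic_idomain.

End PadicIntegers.

Definition Zp (p : nat) (pr : prime p) : idomainType := padic_int pr.
Definition Qp (p : nat) (pr : prime p) : fieldType := {fraction (Zp pr)}.

Section RingOfIntegers.
Variables (p : nat) (pr : prime p) (F : fieldExtType (Qp pr)).

Definition Zp_in : Zp pr -> F := in_alg F \o @tofrac (Zp pr).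
HB.instance Definition _ := GRing.RMorphism.on Zp_in.

Definition integral_pred : {pred F} := fun x => `[< integralOver Zp_in x >].

Lemma integral_pred_subring : subring_closed integral_pred.
Proof.
split; first by apply/asboolP; exact: integral1.
  by move=> x y /asboolP hx /asboolP hy; apply/asboolP; exact: integral_sub.
by move=> x y /asboolP hx /asboolP hy; apply/asboolP; exact: integral_mul.
Qed.
HB.instance Definition _ :=
  GRing.isSubringClosed.Build F integral_pred integral_pred_subring.

Record int_ring := IntRing { int_val :> F; _ : int_val \in integral_pred }.
HB.instance Definition _ := [isSub for int_val].
HB.instance Definition _ := [Choice of int_ring by <:].
HB.instance Definition _ := [SubChoice_isSubComNzRing of int_ring by <:].

End RingOfIntegers.

Arguments integral_pred {p pr} F.

Notation "''o_' F" := (int_ring F) (at level 8, F at level 2, format "''o_' F").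

Section Uniformizer.
Variables (p : nat) (pr : prime p) (F : fieldExtType (Qp pr)).

Definition is_unif (pi : 'o_F) : Prop :=
  pi != 0 /\
  forall x : 'o_F, (exists y, x = pi * y) <-> ~ (exists y, x * y = 1).

Definition congr_mod (pi x y : 'o_F) : Prop := exists z, x - y = pi * z.

(* The residue field 'o_F / pi has q elements. *)
Definition residue_card (pi : 'o_F) (q : nat) : Prop :=
  exists r : 'I_q -> 'o_F, forall x, exists! i, congr_mod pi x (r i).

End Uniformizer.

(* A power series is the function giving its coefficients.  The coefficient of
   a product or of a composition at a monomial m only involves monomials of
   degree at most mdeg m, so both are computed on truncated polynomials. *)

Definition fps (n : nat) (R : Type) : Type := 'X_{1..n} -> R.

Section PowerSeries.
Variables (n : nat) (R : comNzRingType).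
Implicit Types f g h : fps n R.

HB.instance Definition _ := gen_eqMixin (fps n R).
HB.instance Definition _ := gen_choiceMixin (fps n R).

Definition fps_trunc (N : nat) f : {mpoly R[n]} :=
  \sum_(m : 'X_{1..n < N}) f m *: 'X_[m].

Definition fps_const (c : R) : fps n R := fun m => if m == 0%MM then c else 0.
Definition fps_var (i : 'I_n) : fps n R := fun m => (m == U_(i)%MM)%:R.
Definition fps_add f g : fps n R := fun m => f m + g m.
Definition fps_opp f : fps n R := fun m => - f m.
Definition fps_mul f g : fps n R :=
  fun m => (fps_trunc (mdeg m).+1 f * fps_trunc (mdeg m).+1 g)@_m.

Lemma fps_truncE N f m : (mdeg m < N)%N -> (fps_trunc N f)@_m = f m.
Proof.
move=> hm; rewrite /fps_trunc raddf_sum /= (bigD1 (BMultinom hm)) //=.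
rewrite mcoeffZ mcoeffX eqxx mulr1 big1 ?addr0 // => m' ne.
by rewrite mcoeffZ mcoeffX; move: ne; rewrite bmeqP /= => /negPf ->; rewrite mulr0.
Qed.

Lemma mcoeffM_eq (P P' Q Q' : {mpoly R[n]}) m :
  (forall k, (mdeg k <= mdeg m)%N -> P@_k = P'@_k) ->
  (forall k, (mdeg k <= mdeg m)%N -> Q@_k = Q'@_k) ->
  (P * Q)@_m = (P' * Q')@_m.
Proof.
move=> hP hQ; rewrite !mcoeffM; apply: eq_bigr => k _.
by rewrite hP ?hQ // -ltnS bmdeg.
Qed.

Lemma fps_mulE N f g m : (mdeg m < N)%N ->
  fps_mul f g m = (fps_trunc N f * fps_trunc N g)@_m.
Proof.
by move=> hm; apply: mcoeffM_eq => k hk; rewrite !fps_truncE ?ltnS //;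
  apply: leq_ltn_trans hm.
Qed.

Lemma fps_addA : associative fps_add.
Proof. by move=> f g h; apply/funext => m; rewrite /fps_add addrA. Qed.
Lemma fps_addC : commutative fps_add.
Proof. by move=> f g; apply/funext => m; rewrite /fps_add addrC. Qed.
Lemma fps_add0 : left_id (fun _ => 0) fps_add.
Proof. by move=> f; apply/funext => m; rewrite /fps_add add0r. Qed.
Lemma fps_addN : left_inverse (fun _ => 0) fps_opp fps_add.
Proof. by move=> f; apply/funext => m; rewrite /fps_add addNr. Qed.
HB.instance Definition _ := GRing.isZmodule.Build (fps n R)
  fps_addA fps_addC fps_add0 fps_addN.

Lemma fps_mulA : associative fps_mul.
Proof.
move=> f g h; apply/funext => m.
pose T := fps_trunc (mdeg m).+1.
transitivity (T f * (T g * T h))@_m.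
  apply: mcoeffM_eq => // k hk.
  by rewrite fps_truncE ?ltnS // (@fps_mulE (mdeg m).+1).
rewrite mulrA; apply: mcoeffM_eq => // k hk.
by rewrite fps_truncE ?ltnS // (@fps_mulE (mdeg m).+1).
Qed.
Lemma fps_mulC : commutative fps_mul.
Proof. by move=> f g; apply/funext => m; rewrite /fps_mul mulrC. Qed.
Lemma fps_mul1 : left_id (fps_const 1) fps_mul.
Proof.
move=> f; apply/funext => m; rewrite -[RHS](@fps_truncE (mdeg m).+1) //.
rewrite -[in RHS](mul1r (fps_trunc _ f)); apply: mcoeffM_eq => // k hk.
by rewrite fps_truncE ?ltnS // mcoeff1 /fps_const; case: eqP.
Qed.
Lemma fps_mulD : left_distributive fps_mul fps_add.
Proof.
move=> f g h; apply/funext => m.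
rewrite /fps_add /fps_mul -mcoeffD -mulrDl; apply: mcoeffM_eq => // k hk.
by rewrite mcoeffD !fps_truncE.
Qed.
Lemma fps_neq0 : fps_const 1 != 0.
Proof.
apply/eqP => /(congr1 (fun f : fps n R => f 0%MM)).
by rewrite /fps_const eqxx => /eqP; rewrite (negPf (oner_neq0 R)).
Qed.
HB.instance Definition _ := GRing.Zmodule_isComNzRing.Build (fps n R)
  fps_mulA fps_mulC fps_mul1 fps_mulD fps_neq0.

End PowerSeries.

(* f(g_0, ..., g_(r-1)); only meaningful when every g_i has zero constant
   term. *)
Definition fps_subst (r n : nat) (R : comNzRingType)
    (f : fps r R) (g : 'I_r -> fps n R) : fps n R :=
  fun m => (fps_trunc (mdeg m).+1 f \mPo
            [tuple fps_trunc (mdeg m).+1 (g i) | i < r])@_m.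

Section OneTwoVariables.
Variables (n : nat) (R : comNzRingType).

Definition subst1 (f : fps 1 R) (g : fps n R) : fps n R :=
  fps_subst f (fun _ => g).

Definition subst2 (f : fps 2 R) (g h : fps n R) : fps n R :=
  fps_subst f (fun i => if i == ord0 then g else h).

Definition coefX (f : fps 1 R) (k : nat) : R := f [multinom k | _ < 1].

End OneTwoVariables.

Arguments fps_var {n R} i.
Arguments fps_const {n R} c.

Section LubinTate.
Variables (p : nat) (pr : prime p) (F : fieldExtType (Qp pr)).

Let X : fps 1 'o_F := fps_var ord0.
Let V (i : 'I_3) : fps 3 'o_F := fps_var i.
Let x2 : fps 2 'o_F := fps_var ord0.
Let y2 : fps 2 'o_F := fps_var ord_max.

(* G is the addition law X (+) Y and br a is the series [a](X); pi and q are
   the uniformizer and the cardinality of the residue field.  A formal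
   'o_F-module is attached to pi when [pi](X) = X^q modulo pi. *)
Record lubin_tate (pi : 'o_F) (q : nat) (G : fps 2 'o_F)
    (br : 'o_F -> fps 1 'o_F) : Prop := LubinTate {
  lt_const : G 0%MM = 0;
  lt_add0 : subst2 G X 0 = X;
  lt_addC : subst2 G y2 x2 = G;
  lt_addA : subst2 G (subst2 G (V 0) (V 1)) (V 2%:R)
          = subst2 G (V 0) (subst2 G (V 1) (V 2%:R));
  lt_br0 : forall a, coefX (br a) 0 = 0;
  lt_br1 : forall a, coefX (br a) 1 = a;
  lt_br_end : forall a,
    subst1 (br a) G = subst2 G (subst1 (br a) x2) (subst1 (br a) y2);
  lt_br_one : br 1 = X;
  lt_br_add : forall a b, br (a + b) = subst2 G (br a) (br b);
  lt_br_mul : forall a b, br (a * b) = subst1 (br a) (br b);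
  lt_frob : forall k, congr_mod pi (coefX (br pi) k) (k == q)%:R }.

End LubinTate.

Section Trace.
Variables (B : comNzRingType) (A : B -> Prop).

Definition free_basis (d : nat) (e : 'I_d -> B) : Prop :=
  forall b, exists! c : 'rV[B]_d,
    (forall i, A (c 0 i)) /\ b = \sum_i c 0 i * e i.

(* t is the trace Tr_(B/A)(b), for B finite free over the subring A. *)
Definition is_trace (b t : B) : Prop :=
  exists (d : nat) (e : 'I_d -> B) (M : 'M[B]_d),
    [/\ free_basis e, forall i j, A (M i j),
        forall j, b * e j = \sum_i M i j * e i & t = \tr M].

End Trace.

Section Psi.
Variables (p : nat) (pr : prime p) (F : fieldExtType (Qp pr)).
Variables (pi : 'o_F) (br : 'o_F -> fps 1 'o_F).

Definition phi (f : fps 1 'o_F) : fps 1 'o_F := subst1 f (br pi).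

Definition phi_image (f : fps 1 'o_F) : Prop := exists g, f = phi g.

(* h = psi f, that is phi h = pi^-1 Tr f. *)
Definition is_psi (f h : fps 1 'o_F) : Prop :=
  exists t, is_trace phi_image f t /\ fps_const pi * phi h = t.

Definition psi_ker (f : fps 1 'o_F) : Prop := is_psi f 0.

End Psi.

Section Pol.
Variables (p : nat) (pr : prime p) (F : fieldExtType (Qp pr)).
Variables (br : 'o_F -> fps 1 'o_F).

Definition Int (P : {poly F}) : Prop :=
  forall a : 'o_F, P.[int_val a] \in integral_pred F.

(* P = c_(f,k).  Such a P is unique because 'o_F is infinite. *)
Definition is_coef_poly (f : fps 1 'o_F) (k : nat) (P : {poly F}) : Prop :=
  forall a : 'o_F, P.[int_val a] = int_val (coefX (subst1 f (br a)) k).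

Definition Pol (M : fps 1 'o_F -> Prop) (P : {poly F}) : Prop :=
  exists (d : nat) (a : 'I_d -> 'o_F) (Q : 'I_d -> {poly F}),
    (forall i, exists f k, M f /\ is_coef_poly f k (Q i)) /\
    P = \sum_i int_val (a i) *: Q i.

End Pol.

(* Main.v *)
(* Modulo pi one has [pi](X) = X^q, so phi^j(g) o [a] = phi^j(g o [a]) is
   (g o [a])(X^(q^j)).  If psi f = 0 then h = f phi^j(g) is also killed by psi,
   because the trace is phi(o_F[[X]])-linear, and comparing the coefficients of
   X^(m + q^j l) in h o [a] gives, for q^j > m,
     c_{h,m+q^j l} = c_{f,m} c_{g,l} + sum_(i < l) c_{f,m+q^j(l-i)} c_{g,i}
   modulo pi.  Strong induction on l concludes. *)
Require Import Defs.
From mathcomp Require Import all_boot all_order all_algebra all_field.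
From mathcomp Require Import mpoly.
From mathcomp Require Import zify ring.
From mathcomp Require boolp.
Import GRing.Theory.
Local Open Scope ring_scope.

Local Notation coefX := Defs.coefX.

(** * Coefficients of one-variable series through univariate polynomials *)

Section Coefficients.
Context {R : comNzRingType}.
Implicit Types (f g h u v w : fps 1 R) (P Q : {poly R}) (n k N : nat).

Definition monoX k : 'X_{1..1} := [multinom k | _ < 1].

Lemma monoX_surj (m : 'X_{1..1}) : m = monoX (mdeg m).
Proof. by apply/mnmP => i; rewrite mnmE mdegE big_ord1 (ord1 i). Qed.

Lemma mdeg_monoX k : mdeg (monoX k) = k.
Proof. by rewrite mdegE big_ord1 mnmE. Qed.

Lemma fps_ext f g : (forall n, coefX f n = coefX g n) -> f = g.
Proof. by move=> e; apply/boolp.funext => m; rewrite (monoX_surj m); exact: e. Qed.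

Definition tpoly N f : {poly R} := \poly_(i < N) coefX f i.

(** Evaluation at the only variable identifies [{poly R}] with [{mpoly R[1]}], so products and
    composites of truncations can be computed on univariate polynomials. *)
Definition mpoly_of_poly : {rmorphism {poly R} -> {mpoly R[1]}} :=
  horner_alg ('X_ord0 : {mpoly R[1]}).

Lemma mpoly_of_polyE P :
  mpoly_of_poly P = \sum_(i < size P) P`_i *: 'X_ord0 ^+ i.
Proof.
rewrite -{1}(coefK P) poly_def rmorph_sum /=; apply: eq_bigr => i _.
by rewrite linearZ /= rmorphXn /= horner_algX mulr_algl.
Qed.

Lemma mcoeff_mpoly_of_poly P m : (mpoly_of_poly P)@_m = P`_(mdeg m).
Proof.
rewrite mpoly_of_polyE raddf_sum /=.
have e (i : nat) : ('X_ord0 ^+ i : {mpoly R[1]})@_m = (i == mdeg m)%:R.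
  rewrite mpolyXn mcoeffX; congr (_%:R); congr nat_of_bool.
  apply/eqP/eqP => [<-|->].
    by rewrite mdegMn mdeg1 mul1n.
  by apply/mnmP => j; rewrite (ord1 j) mulmnE mnm1E mdegE big_ord1 mul1n.
case: (ltnP (mdeg m) (size P)) => h; last first.
  rewrite nth_default // big1 // => i _; rewrite mcoeffZ e.
  by rewrite ltn_eqF ?mulr0 // (leq_trans (ltn_ord i)).
rewrite (bigD1 (Ordinal h)) //= mcoeffZ e eqxx mulr1 big1 ?addr0 // => i.
by rewrite -val_eqE /= mcoeffZ e => /negPf ->; rewrite mulr0.
Qed.

Lemma fps_trunc_tpoly N f : fps_trunc N f = mpoly_of_poly (tpoly N f).
Proof.
apply/mpolyP => m; rewrite mcoeff_mpoly_of_poly coef_poly.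
case: ltnP => h; first by rewrite fps_truncE // {1}(monoX_surj m).
rewrite /fps_trunc raddf_sum big1 // => k _ /=.
rewrite mcoeffZ mcoeffX; case: eqP => [e|]; last by rewrite mulr0.
by have := bmdeg k; rewrite e ltnNge h.
Qed.

Lemma coefX_mul f g n N : (n < N)%N ->
  coefX (f * g) n = (tpoly N f * tpoly N g)`_n.
Proof.
move=> h; rewrite /coefX -/(monoX n).
have -> : (f * g) (monoX n) = (fps_trunc N f * fps_trunc N g)@_(monoX n).
  by apply: fps_mulE; rewrite mdeg_monoX.
by rewrite !fps_trunc_tpoly -rmorphM mcoeff_mpoly_of_poly mdeg_monoX.
Qed.

Lemma coefXM f g n :
  coefX (f * g) n = \sum_(i < n.+1) coefX f i * coefX g (n - i).
Proof.
rewrite (@coefX_mul _ _ _ n.+1) // coefM; apply: eq_bigr => i _.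
by rewrite !coef_poly ltn_ord ltnS leq_subr.
Qed.

Lemma coefX1 n : coefX (1 : fps 1 R) n = (n == 0)%:R.
Proof.
rewrite /coefX -/(monoX n) -[LHS]/(if monoX n == 0%MM then 1 else 0).
have -> : (monoX n == 0%MM) = (n == 0) by rewrite -mdeg_eq0 mdeg_monoX.
by case: eqP.
Qed.

Lemma mpoly_of_poly_comp P Q :
  mpoly_of_poly P \mPo [tuple mpoly_of_poly Q | _ < 1] = mpoly_of_poly (P \Po Q).
Proof.
rewrite comp_polyE (mpoly_of_polyE P) !rmorph_sum /=.
apply: eq_bigr => i _.
rewrite comp_mpolyZ rmorphXn /= comp_mpolyXU -tnth_nth tnth_mktuple.
by rewrite linearZ /= rmorphXn /= mulr_algl.
Qed.

Lemma coefX_pow g n N i : (n < N)%N ->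
  coefX (g ^+ i) n = (tpoly N g ^+ i)`_n.
Proof.
elim: i n => [|i IH] n h; first by rewrite !expr0 coefX1 coef1.
rewrite !exprS coefXM coefM; apply: eq_bigr => k _.
by rewrite IH ?coef_poly ?(leq_ltn_trans (leq_subr _ _)) //
  (leq_ltn_trans _ h) // -ltnS.
Qed.

(** The sum stops at [n] because [fps_subst] truncates [f] there; when [g] has no constant term, the
    later terms vanish anyway. *)
Lemma coefX_comp f g n :
  coefX (subst1 f g) n = \sum_(i < n.+1) coefX f i * coefX (g ^+ i) n.
Proof.
rewrite /coefX /subst1 /fps_subst -/(monoX n) mdeg_monoX.
rewrite !fps_trunc_tpoly mpoly_of_poly_comp mcoeff_mpoly_of_poly mdeg_monoX.
rewrite {2}/tpoly poly_def raddf_sum coef_sum.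
apply: eq_bigr => i _; rewrite /= comp_polyZ comp_Xn_poly coefZ.
by congr (_ * _); rewrite -(@coefX_pow g n n.+1).
Qed.

End Coefficients.

(** * Substitution of series without constant term *)

Section Composition.
Context {R : comNzRingType}.
Implicit Types (f g h u v w : fps 1 R) (P Q : {poly R}) (n k N : nat).

Lemma coef_exp_low Q i n : Q`_0 = 0 -> (n < i)%N -> (Q ^+ i)`_n = 0.
Proof.
move=> Q0; elim: i n => // i IH n ni; rewrite exprS coefM big1 // => k _.
have [->|k0] := posnP k; first by rewrite Q0 mul0r.
by rewrite IH ?mulr0 //; have := ltn_ord k; lia.
Qed.

Lemma coefX_exp_low g i n : coefX g 0 = 0 -> (n < i)%N -> coefX (g ^+ i) n = 0.
Proof.
by move=> g0 ni; rewrite (@coefX_pow _ _ _ n.+1) // coef_exp_low // coef_poly.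
Qed.

(** The lowest term of [g ^+ n] is the n-th power of the linear term of [g]: in the convolution only
    index 1 survives. *)
Lemma coefX_exp_diag g n : coefX g 0 = 0 -> coefX (g ^+ n) n = coefX g 1 ^+ n.
Proof.
move=> g0; elim: n => [|n IH]; first by rewrite !expr0 coefX1.
rewrite !exprS coefXM 2!big_ord_recl /= g0 mul0r add0r subSS subn0 IH.
rewrite big1 ?addr0 // => i _; rewrite coefX_exp_low ?mulr0 //=.
by rewrite /bump /=; have := ltn_ord i; lia.
Qed.

(** X^(n+1) divides P - P' and X divides Q, so X^(n+1) divides the difference of the composites. *)
Lemma comp_poly_low P P' Q n : Q`_0 = 0 ->
  (forall k, (k <= n)%N -> P`_k = P'`_k) -> (P \Po Q)`_n = (P' \Po Q)`_n.
Proof.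
move=> Q0 e; apply/eqP; rewrite -subr_eq0 -coefB -comp_polyB coef_comp_poly.
apply/eqP; apply: big1 => i _; have [le_in|lt_ni] := leqP i n.
  by rewrite coefB e // subrr mul0r.
by rewrite coef_exp_low ?mulr0.
Qed.

Lemma coefX_comp_widen f g n N : coefX g 0 = 0 -> (n < N)%N ->
  coefX (subst1 f g) n = \sum_(i < N) coefX f i * coefX (g ^+ i) n.
Proof.
move=> g0 nN; rewrite coefX_comp.
rewrite (big_ord_widen N (fun i => coefX f i * coefX (g ^+ i) n)) //.
rewrite big_mkcond; apply: eq_bigr => i _; case: ltnP => // lt_ni.
by rewrite coefX_exp_low ?mulr0.
Qed.

Lemma coefX_comp_poly f g n N : coefX g 0 = 0 -> (n < N)%N ->
  coefX (subst1 f g) n = (tpoly N f \Po tpoly N g)`_n.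
Proof.
move=> g0 nN; rewrite (coefX_comp_widen _ _ _ _ g0 nN).
rewrite {2}/tpoly poly_def raddf_sum coef_sum.
apply: eq_bigr => i _; rewrite /= comp_polyZ comp_Xn_poly coefZ.
by congr (_ * _); rewrite -(@coefX_pow _ g n N).
Qed.

(** Truncating [f * h] and multiplying the truncations agree up to degree [n]; [comp_poly_low]
    ignores the rest, and composition of polynomials is multiplicative. *)
Lemma subst1M f h g : coefX g 0 = 0 ->
  subst1 (f * h) g = subst1 f g * subst1 h g.
Proof.
move=> g0; apply: fps_ext => n.
rewrite (@coefX_comp_poly _ _ _ n.+1) // coefXM.
rewrite (@comp_poly_low _ (tpoly n.+1 f * tpoly n.+1 h)); first last.
- by move=> k kn; rewrite -(@coefX_mul _ _ _ k n.+1) // coef_poly ltnS kn.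
- by rewrite coef_poly.
rewrite comp_polyM coefM; apply: eq_bigr => i _.
by rewrite !(@coefX_comp_poly _ _ _ n.+1) // ltnS leq_subr.
Qed.

Lemma subst11 g : subst1 (1 : fps 1 R) g = 1.
Proof.
apply: fps_ext => n; rewrite coefX_comp big_ord_recl expr0 !coefX1 mul1r.
by rewrite big1 ?addr0 // => i _; rewrite coefX1 mul0r.
Qed.

Lemma subst1_exp f g i : coefX g 0 = 0 -> subst1 (f ^+ i) g = subst1 f g ^+ i.
Proof.
move=> g0; elim: i => [|i IH]; first by rewrite !expr0 subst11.
by rewrite !exprS subst1M // IH.
Qed.

Lemma subst1A f u v : coefX u 0 = 0 -> coefX v 0 = 0 ->
  subst1 (subst1 f u) v = subst1 f (subst1 u v).
Proof.
move=> u0 v0; apply: fps_ext => n; rewrite !coefX_comp.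
under [RHS]eq_bigr => j _ do rewrite -subst1_exp // coefX_comp mulr_sumr.
rewrite [RHS]exchange_big; apply: eq_bigr => i _ /=.
(* The inner range j <= i is widened to j <= n, so that both double sums run over the same
   square. *)
rewrite (@coefX_comp_widen _ _ _ n.+1) // mulr_suml.
by apply: eq_bigr => j _; rewrite mulrA.
Qed.

Lemma subst10 g : subst1 (0 : fps 1 R) g = 0.
Proof.
by apply: fps_ext => n; rewrite coefX_comp big1 // => i _; rewrite mul0r.
Qed.

End Composition.

(** * Congruences modulo a constant, and series congruent to u(X^Q) *)

Section Congruence.
Context {R : comNzRingType} (c : R).
Implicit Types (x y z : R) (f u w : fps 1 R).

(** Over ['o_F] with [c = pi] this unfolds to [congr_mod], so [lt_frob] applies as it stands. *)
Definition cong x y : Prop := exists z, x - y = c * z.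

Lemma cong_refl x : cong x x.
Proof. by exists 0; rewrite subrr mulr0. Qed.

Lemma cong_trans y x z : cong x y -> cong y z -> cong x z.
Proof.
by case=> s es [t et]; exists (s + t); rewrite mulrDr -es -et addrA subrK.
Qed.

Lemma congD x x' y y' : cong x x' -> cong y y' -> cong (x + y) (x' + y').
Proof.
by case=> s es [t et]; exists (s + t); rewrite mulrDr -es -et opprD addrACA.
Qed.

Lemma congM x x' y y' : cong x x' -> cong y y' -> cong (x * y) (x' * y').
Proof.
case=> s es [t et]; exists (s * y + x' * t).
by rewrite mulrDr mulrA -es mulrCA -et; ring.
Qed.

Lemma cong_subr x y z : cong x (y + z) -> cong (x - y) z.
Proof. by case=> t et; exists t; rewrite -et opprD addrA. Qed.

Lemma cong_sum n (F G : 'I_n -> R) :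
  (forall i, cong (F i) (G i)) -> cong (\sum_i F i) (\sum_i G i).
Proof.
by move=> e; elim/big_rec2: _ => [|i x y _]; [exact: cong_refl|exact: congD].
Qed.

(* w = u(X^Q) modulo c. *)
Definition spread Q w u : Prop :=
  forall n, cong (coefX w n) (if (Q %| n)%N then coefX u (n %/ Q) else 0).

Lemma cong_exp_frob q w i n :
  (forall k, cong (coefX w k) (k == q)%:R) ->
  cong (coefX (w ^+ i) n) (n == q * i)%N%:R.
Proof.
move=> ew; elim: i n => [|i IH] n.
  by rewrite expr0 coefX1 muln0; exact: cong_refl.
rewrite exprS coefXM.
apply: (cong_trans (\sum_(k < n.+1) ((k == q :> nat)%:R * (n - k == q * i)%N%:R))).
  by apply: cong_sum => k; apply: congM.
(* Only k = q contributes to the convolution, and it is in range exactly when q <= n; otherwise n <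
   q * (i + 1) and both sides vanish. *)
have [le_qn|lt_nq] := leqP q n.
  rewrite (bigD1 (Ordinal (le_qn : (q < n.+1)%N))) //= eqxx mul1r big1 ?addr0.
    by rewrite -(eqn_add2r q) subnK // mulnS [(q + _)%N]addnC; exact: cong_refl.
  by move=> k; rewrite -val_eqE /= => /negPf ->; rewrite mul0r.
rewrite big1 => [|k _].
  rewrite mulnS (_ : (n == _) = false); first exact: cong_refl.
  by apply/eqP => e; move: lt_nq; rewrite e ltnNge leq_addr.
have ->: (k == q :> nat) = false by apply/eqP => e; have := ltn_ord k; lia.
by rewrite mul0r.
Qed.

(** Modulo [c], w^i is X^(q i); positivity of [q] leaves at most one i with q i = n, and places it
    in the range i <= n. *)
Lemma spread_comp q w u : (0 < q)%N ->
  (forall k, cong (coefX w k) (k == q)%:R) -> spread q (subst1 u w) u.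
Proof.
move=> q0 ew n; rewrite coefX_comp.
apply: (cong_trans (\sum_(i < n.+1) coefX u i * (n == q * i)%N%:R)).
  apply: cong_sum => i; apply: congM; first exact: cong_refl.
  exact: cong_exp_frob.
case: ifP => [/dvdnP[k ek]|nd].
  have hk : (k < n.+1)%N by rewrite ltnS ek leq_pmulr.
  rewrite (bigD1 (Ordinal hk)) //= big1 => [|i].
    by rewrite addr0 ek mulnK // mulnC eqxx mulr1; exact: cong_refl.
  rewrite -val_eqE /= => /negPf ik.
  suff ->: (n == q * i)%N = false by rewrite mulr0.
  by rewrite {1}ek [(k * q)%N]mulnC eqn_pmul2l // eq_sym.
rewrite big1 => [|i _]; first exact: cong_refl.
case: eqP => e; rewrite ?mulr0 //; have d : (q %| q * i)%N by apply: dvdn_mulr.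
by rewrite -e nd in d.
Qed.

(** Induction on [j]: q^(j+1) divides n exactly when q divides n and q^j divides n / q. *)
Lemma spread_iter q w u j : (0 < q)%N ->
  (forall k, cong (coefX w k) (k == q)%:R) ->
  spread (q ^ j) (iter j (fun v => subst1 v w) u) u.
Proof.
move=> q0 ew; elim: j => [|j IH] n.
  by rewrite expn0 dvd1n divn1; exact: cong_refl.
rewrite iterS; apply: cong_trans (spread_comp _ _ _ q0 ew n) _.
rewrite expnS divnMA; case: ifP => [d|nd].
  by have := IH (n %/ q)%N; rewrite dvdn_divRL // mulnC.
case: ifP => [d|_]; last exact: cong_refl.
by rewrite (dvdn_trans (dvdn_mulr _ (dvdnn q)) d) in nd.
Qed.

(** This is the coefficient of X^(m + Q l) in f(X) u(X^Q); the bound m < Q forces i <= l. *)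
Lemma cong_mul_spread f w u Q m l : spread Q w u -> (m < Q)%N ->
  cong (coefX (f * w) (m + Q * l))
       (\sum_(i < l.+1) coefX f (m + Q * (l - i)) * coefX u i).
Proof.
move=> sp mQ; have Q0 : (0 < Q)%N by apply: leq_ltn_trans mQ.
set N := (m + Q * l)%N; rewrite mulrC coefXM.
apply: (cong_trans
  (\sum_(s < N.+1 | (Q %| s)%N) coefX u (s %/ Q) * coefX f (N - s))).
  rewrite [X in cong _ X]big_mkcond; apply: cong_sum => s.
  have := congM _ _ _ _ (sp s) (cong_refl (coefX f (N - s))).
  by case: ifP => // _; rewrite mul0r.
have lt_iN (i : 'I_l.+1) : (Q * i < N.+1)%N.
  by rewrite ltnS (leq_trans _ (leq_addl _ _)) // leq_mul2l -ltnS ltn_ord orbT.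
(* The multiples of [Q] not exceeding [N] are the Q i with i <= l, because N < Q (l + 1). *)
rewrite (reindex_onto (fun i : 'I_l.+1 => inord (Q * i))
                      (fun s => inord (s %/ Q))) /=.
  under eq_bigl => i do rewrite inordK // dvdn_mulr // mulKn // inord_val eqxx.
  have ->: \sum_(i < l.+1) coefX u (inord (n' := N) (Q * i) %/ Q) *
                           coefX f (N - inord (n' := N) (Q * i))
    = \sum_(i < l.+1) coefX f (m + Q * (l - i)) * coefX u i; last exact: cong_refl.
  apply: eq_bigr => i _; rewrite inordK // mulKn // mulrC; congr (coefX f _ * _).
  by rewrite mulnBr addnBA // leq_mul2l -ltnS ltn_ord orbT.
move=> s d; apply/val_inj; rewrite /= inordK //.
rewrite inordK; first by rewrite mulnC divnK.
by rewrite ltn_divLR //; have := ltn_ord s; rewrite /N; nia.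
Qed.

End Congruence.

(** * Functions on the ring of integers given by polynomials over the field *)

Section CoefficientPolynomials.
Context {p : nat} {pr : prime p} {F : fieldExtType (Qp pr)}.
Implicit Types (a b : 'o_F) (s t : 'o_F -> 'o_F) (w : 'o_F -> fps 1 'o_F).

Lemma int_valD a b : int_val (a + b) = int_val a + int_val b.
Proof. exact: (rmorphD (val : 'o_F -> F)). Qed.

Lemma int_valN a : int_val (- a) = - int_val a.
Proof. exact: (rmorphN (val : 'o_F -> F)). Qed.

Lemma int_valM a b : int_val (a * b) = int_val a * int_val b.
Proof. exact: (rmorphM (val : 'o_F -> F)). Qed.

Lemma int_val0 : int_val (0 : 'o_F) = 0.
Proof. exact: (rmorph0 (val : 'o_F -> F)). Qed.

Lemma int_val1 : int_val (1 : 'o_F) = 1.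
Proof. exact: (rmorph1 (val : 'o_F -> F)). Qed.

Lemma int_valX a n : int_val (a ^+ n) = int_val a ^+ n.
Proof. exact: (rmorphXn (val : 'o_F -> F)). Qed.

Lemma int_val_inj : injective (@int_val p pr F).
Proof. exact: val_inj. Qed.

(** The witness has coefficients in [F] but integral values on ['o_F], so it lies in [Int]. *)
Definition polyfun s : Prop :=
  exists P : {poly F}, forall a, P.[int_val a] = int_val (s a).

Lemma polyfun_ext s t : s =1 t -> polyfun s -> polyfun t.
Proof. by move=> e [P hP]; exists P => a; rewrite hP e. Qed.

Lemma polyfun_const b : polyfun (fun _ => b).
Proof. by exists (int_val b)%:P => a; rewrite hornerC. Qed.

Lemma polyfunD s t : polyfun s -> polyfun t ->
  polyfun (fun a => s a + t a).
Proof.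
by move=> [P hP] [Q hQ]; exists (P + Q) => a; rewrite hornerD hP hQ int_valD.
Qed.

Lemma polyfunM s t : polyfun s -> polyfun t ->
  polyfun (fun a => s a * t a).
Proof.
by move=> [P hP] [Q hQ]; exists (P * Q) => a; rewrite hornerM hP hQ int_valM.
Qed.

Lemma polyfun_sum n (s : 'I_n -> 'o_F -> 'o_F) :
  (forall i, polyfun (s i)) -> polyfun (fun a => \sum_i s i a).
Proof.
elim: n s => [|n IH] s hs.
  by apply: (polyfun_ext (fun=> 0)) (polyfun_const 0) => a; rewrite big_ord0.
apply: (polyfun_ext (fun a => s ord0 a + \sum_(i < n) s (lift ord0 i) a)).
  by move=> a; rewrite big_ord_recl.
by apply: polyfunD => //; apply: IH.
Qed.

Lemma polyfun_exp w i n :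
  (forall k, (k <= n)%N -> polyfun (fun a => coefX (w a) k)) ->
  polyfun (fun a => coefX (w a ^+ i) n).
Proof.
elim: i n => [|i IH] n hw.
  apply: (polyfun_ext _ _ _ (polyfun_const (n == 0)%:R)) => a.
  by rewrite expr0 coefX1.
apply: (polyfun_ext
  (fun a => \sum_(k < n.+1) coefX (w a) k * coefX (w a ^+ i) (n - k))).
  by move=> a; rewrite exprS coefXM.
apply: polyfun_sum => k; apply: polyfunM; first by apply: hw; rewrite -ltnS.
by apply: IH => k' le; apply: hw; rewrite (leq_trans le) // leq_subr.
Qed.

(* As [w a] has no constant term, the top coefficient does not enter. *)
Lemma polyfun_exp2 w i n : (forall a, coefX (w a) 0 = 0) ->
  (forall k, (k < n)%N -> polyfun (fun a => coefX (w a) k)) ->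
  polyfun (fun a => coefX (w a ^+ i.+2) n).
Proof.
move=> w0 hw.
apply: (polyfun_ext
  (fun a => \sum_(k < n.+1) coefX (w a) k * coefX (w a ^+ i.+1) (n - k))).
  by move=> a; rewrite [in RHS]exprS coefXM.
apply: polyfun_sum => k.
have [k0|k0] := posnP k.
  by apply: (polyfun_ext _ _ _ (polyfun_const 0)) => a; rewrite k0 w0 mul0r.
have [kn|kn] := ltnP k n; last first.
  apply: (polyfun_ext _ _ _ (polyfun_const 0)) => a.
  by rewrite (eqP (_ : (n - k)%N == 0%N)) ?subn_eq0 // coefX_exp_low ?mulr0.
apply: polyfunM; first exact: hw.
by apply: polyfun_exp => k' le; apply: hw; lia.
Qed.

End CoefficientPolynomials.

(** The same basis serves: if [M] is the matrix of multiplication by [b], then [u *: M] is that of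
    [b * u], with entries still in [A]. *)
Lemma is_trace_mul {B : comNzRingType} (A : B -> Prop) (b t u : B) :
  (forall x, A x -> A (u * x)) -> is_trace A b t -> is_trace A (b * u) (u * t).
Proof.
move=> hu [d [e [M [he hM hb ->]]]]; exists d, e, (u *: M); split => //.
- by move=> i j; rewrite mxE; apply: hu.
- move=> j; rewrite mulrAC hb mulr_suml; apply: eq_bigr => i _.
  by rewrite mxE mulrC mulrA.
by rewrite mxtraceZ.
Qed.

(** * Lubin-Tate series: polynomial coefficients, and the kernel of psi *)

Section LubinTateSeries.
Context {p : nat} {pr : prime p} {F : fieldExtType (Qp pr)}.
Context { pi : 'o_F} {q : nat} {G : fps 2 'o_F} {br : 'o_F -> fps 1 'o_F}.
Hypothesis (hpi : is_unif pi) (hLT : lubin_tate pi q G br).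
Implicit Types (a b : 'o_F) (f g : fps 1 'o_F) (P Q : {poly F}).

Lemma unif_not_unit b : pi * b <> 1.
Proof.
move=> e; case: hpi => _ /(_ pi)[+ _]; case; first by exists 1; rewrite mulr1.
by exists b.
Qed.

Lemma int_val_unif_neq0 : int_val pi != 0.
Proof.
apply/eqP => e; case: hpi => /eqP + _; apply.
by apply: int_val_inj; rewrite e int_val0.
Qed.

(** This is the divisor in [polyfun_br]. It equals pi (pi^(n+1) - 1), and pi^(n+1) = 1 would make pi
    a unit. *)
Lemma unif_exp_neq n : int_val pi ^+ n.+2 - int_val pi != 0.
Proof.
rewrite exprS -[X in _ - X]mulr1 -mulrBr mulf_neq0 ?int_val_unif_neq0 //.
rewrite subr_eq0; apply/eqP => e; apply: (unif_not_unit (pi ^+ n)).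
by apply: int_val_inj; rewrite int_valM int_valX int_val1 -exprS.
Qed.

(** By [lt_frob], q = 0 would make the constant coefficient 0 of [pi] congruent to 1, and q = 1
    would do so for its linear coefficient pi; either way pi is a unit. *)
Lemma residue_card_gt1 : (1 < q)%N.
Proof.
case eq: q => [|[|//]]; have := lt_frob hLT.
  move=> /(_ 0) [z]; rewrite eq (lt_br0 hLT) eqxx add0r => e.
  by case: (unif_not_unit (- z)); rewrite mulrN -e opprK.
move=> /(_ 1%N) [z]; rewrite eq (lt_br1 hLT) eqxx => e.
by case: (unif_not_unit (1 - z)); rewrite mulrBr mulr1 -e opprB addrC subrK.
Qed.

Lemma br_comm_unif a : subst1 (br pi) (br a) = subst1 (br a) (br pi).
Proof. by rewrite -!(lt_br_mul hLT) mulrC. Qed.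

(* Comparing the coefficients of X^n in [pi]([a](X)) = [a]([pi](X)) gives
   (pi^n - pi) b_n(a) as a polynomial in b_k(a), k < n, where b_k(a)
   is the coefficient of X^k in [a](X). *)
Lemma polyfun_br n : polyfun (fun a => coefX (br a) n).
Proof.
elim/ltn_ind: n => -[|[|n]] IH.
- by apply: (polyfun_ext _ _ _ (polyfun_const 0)) => a; rewrite (lt_br0 hLT).
- by exists 'X => a; rewrite hornerX (lt_br1 hLT).
(* In degree [n.+2], [A] omits the terms of index 0 and 1 of [pi]([a](X)), and [B] the last term of
   [a]([pi](X)); these are 0, pi b_(n+2) and b_(n+2) pi^(n+2). *)
pose A a := \sum_(i < n.+1) coefX (br pi) i.+2 * coefX (br a ^+ i.+2) n.+2.
pose B a := \sum_(i < n.+2) coefX (br a) i * coefX (br pi ^+ i) n.+2.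
have [P hP] : polyfun A.
  apply: polyfun_sum => i; apply: polyfunM; first exact: polyfun_const.
  by apply: polyfun_exp2 => // a; rewrite (lt_br0 hLT).
have [Q hQ] : polyfun B.
  by apply: polyfun_sum => i; apply: polyfunM; [exact: IH|exact: polyfun_const].
exists ((int_val pi ^+ n.+2 - int_val pi)^-1 *: (P - Q)) => a.
have e1 : coefX (subst1 (br pi) (br a)) n.+2 = pi * coefX (br a) n.+2 + A a.
  rewrite coefX_comp big_ord_recl big_ord_recl addrA.
  by rewrite [X in X * _](lt_br0 hLT) mul0r add0r [X in X * _](lt_br1 hLT).
have e2 : coefX (subst1 (br a) (br pi)) n.+2 = B a + coefX (br a) n.+2 * pi ^+ n.+2.
  rewrite coefX_comp big_ord_recr [coefX (br pi ^+ _) _]coefX_exp_diag.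
    by rewrite (lt_br1 hLT).
  exact: lt_br0 hLT pi.
have e : pi * coefX (br a) n.+2 + A a = B a + coefX (br a) n.+2 * pi ^+ n.+2.
  by rewrite -e1 -e2 br_comm_unif.
rewrite hornerZ hornerD hornerN hP hQ.
have {}e := congr1 (@int_val p pr F) e.
rewrite !int_valD (int_valM pi) (int_valM (coefX _ _)) int_valX in e.
have -> : int_val (A a) - int_val (B a)
    = (int_val pi ^+ n.+2 - int_val pi) * int_val (coefX (br a) n.+2).
  apply: (@addrI _ (int_val pi * int_val (coefX (br a) n.+2))).
  by rewrite addrA e; ring.
by rewrite mulKf // unif_exp_neq.
Qed.

Lemma polyfun_coef f n : polyfun (fun a => coefX (subst1 f (br a)) n).
Proof.
apply: (polyfun_ext (fun a => \sum_(i < n.+1) coefX f i * coefX (br a ^+ i) n)).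
  by move=> a; rewrite coefX_comp.
apply: polyfun_sum => i; apply: polyfunM; first exact: polyfun_const.
by apply: polyfun_exp => k _; exact: polyfun_br.
Qed.

Lemma phiM f g : phi pi br (f * g) = phi pi br f * phi pi br g.
Proof. exact: (subst1M f g _ (lt_br0 hLT pi)). Qed.

(** The trace is linear over the image of [phi], so the trace of the product is [phi g] times that
    of [f], which is pi phi(0) = 0. *)
Lemma psi_ker_mul_phi f g : psi_ker pi br f -> psi_ker pi br (f * phi pi br g).
Proof.
move=> [t [ht h0]]; exists (phi pi br g * t); split.
  by apply: is_trace_mul ht => _ [u ->]; exists (g * u); rewrite phiM.
by rewrite -h0 /phi subst10 !mulr0.
Qed.

(** By associativity of substitution, both sides substitute into [f] the composite of [pi] and [a],
    which commute. *)
Lemma subst1_phi f a : subst1 (phi pi br f) (br a) = phi pi br (subst1 f (br a)).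
Proof.
have br0 := lt_br0 hLT.
apply: etrans (subst1A f _ _ (br0 pi) (br0 a)) _.
by apply: etrans (esym (subst1A f _ _ (br0 a) (br0 pi))); rewrite br_comm_unif.
Qed.

Lemma subst1_iter_phi j f a :
  subst1 (iter j (phi pi br) f) (br a) = iter j (phi pi br) (subst1 f (br a)).
Proof.
elim: j => [|j IH]; first by [].
rewrite 2!iterS -IH; exact: subst1_phi.
Qed.

(** Substituting [a] commutes with phi^j, and phi^j(g([a](X))) is a series in X^(q^j) modulo pi, so
    [cong_mul_spread] applies with Q = q^j. *)
Lemma coef_mul_iter_phi f g j m l a : (m < q ^ j)%N ->
  cong pi (coefX (subst1 (f * iter j (phi pi br) g) (br a)) (m + q ^ j * l))
    (\sum_(i < l.+1) coefX (subst1 f (br a)) (m + q ^ j * (l - i)) *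
                     coefX (subst1 g (br a)) i).
Proof.
move=> mQ; rewrite subst1M ?(lt_br0 hLT) // subst1_iter_phi.
apply: cong_mul_spread => //; apply: spread_iter; last exact: (lt_frob hLT).
exact: ltnW residue_card_gt1.
Qed.

(** * Functions congruent modulo pi to elements of [Pol] *)

Section PolModulo.
Variable M : fps 1 'o_F -> Prop.

Lemma Pol0 : Pol br M 0.
Proof.
by exists 0%N, (fun=> 0), (fun=> 0); split=> [[]|] //; rewrite big_ord0.
Qed.

Lemma PolD P Q : Pol br M P -> Pol br M Q -> Pol br M (P + Q).
Proof.
move=> [d [a [S [hS ->]]]] [d' [a' [S' [hS' ->]]]].
exists (d + d')%N,
  (fun i => match split i with inl j => a j | inr j => a' j end),
  (fun i => match split i with inl j => S j | inr j => S' j end).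
split; first by move=> i; case: (split i).
rewrite big_split_ord; congr (_ + _); apply: eq_bigr => i _.
  by rewrite (unsplitK (inl i)).
by rewrite (unsplitK (inr i)).
Qed.

Lemma PolN P : Pol br M P -> Pol br M (- P).
Proof.
move=> [d [a [S [hS ->]]]]; exists d, (fun i => - a i), S; split => //.
by rewrite -sumrN; apply: eq_bigr => i _; rewrite int_valN scaleNr.
Qed.

Lemma Pol_coef f n P : M f -> is_coef_poly br f n P -> Pol br M P.
Proof.
move=> Mf hP; exists 1%N, (fun=> 1), (fun=> P).
split; first by move=> _; exists f, n.
by rewrite big_ord1 int_val1 scale1r.
Qed.

(** Pointwise form of membership in Pol + pi Int, with one [P] for all [a]; the division by pi is
    postponed to the end. *)
Definition Pol_mod (s : 'o_F -> 'o_F) : Prop :=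
  exists P, Pol br M P /\
    forall a, exists z, int_val (s a) - P.[int_val a] = int_val pi * int_val z.

Lemma Pol_modD s t : Pol_mod s -> Pol_mod t -> Pol_mod (fun a => s a + t a).
Proof.
move=> [P [hP es]] [Q [hQ et]]; exists (P + Q); split; first exact: PolD.
move=> a; have [z ez] := es a; have [y ey] := et a; exists (z + y).
by rewrite !int_valD hornerD mulrDr -ez -ey opprD addrACA.
Qed.

Lemma Pol_modN s : Pol_mod s -> Pol_mod (fun a => - s a).
Proof.
move=> [P [hP es]]; exists (- P); split; first exact: PolN.
move=> a; have [z ez] := es a; exists (- z).
by rewrite !int_valN hornerN mulrN -ez opprB opprK addrC.
Qed.

Lemma Pol_mod_cong s t : (forall a, cong pi (s a) (t a)) -> Pol_mod s -> Pol_mod t.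
Proof.
move=> e [P [hP es]]; exists P; split => // a.
have [z ez] := es a; have [y /(congr1 (@int_val p pr F))] := e a.
rewrite int_valD int_valN int_valM => ey; exists (z - y).
by rewrite int_valD int_valN mulrDr mulrN -ez -ey; ring.
Qed.

Lemma Pol_mod_sum n (s : 'I_n -> 'o_F -> 'o_F) :
  (forall i, Pol_mod (s i)) -> Pol_mod (fun a => \sum_i s i a).
Proof.
elim: n s => [|n IH] s hs.
  exists 0; split; first exact: Pol0.
  by move=> a; exists 0; rewrite big_ord0 int_val0 horner0 subr0 mulr0.
apply: (Pol_mod_cong (fun a => s ord0 a + \sum_(i < n) s (lift ord0 i) a)).
  by move=> a; rewrite big_ord_recl; exact: cong_refl.
by apply: Pol_modD => //; apply: IH.
Qed.

Lemma Pol_mod_coef f n : M f -> Pol_mod (fun a => coefX (subst1 f (br a)) n).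
Proof.
move=> Mf; have [P hP] := polyfun_coef f n.
exists P; split; first exact: (Pol_coef f n).
by move=> a; exists 0; rewrite hP subrr int_val0 mulr0.
Qed.

End PolModulo.

(** The induction on [l] keeps [m] general, since the correction terms lower the index of [g] but
    raise that of [f]. *)
Lemma Pol_mod_mul_coef f g m l : psi_ker pi br f ->
  Pol_mod (psi_ker pi br)
    (fun a => coefX (subst1 f (br a)) m * coefX (subst1 g (br a)) l).
Proof.
move=> hf; elim/ltn_ind: l m => l IH m.
(* Since q > 1, m + 1 < q^(m+1). *)
set j := m.+1; have mQ : (m < q ^ j)%N.
  by apply: leq_trans (ltnW (ltn_expl _ residue_card_gt1)).
set h := f * iter j (phi pi br) g.
(* As [j] is a successor, the iterate is [phi] of a series. *)
have hh : psi_ker pi br h by apply: psi_ker_mul_phi.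
apply: (Pol_mod_cong _ (fun a => coefX (subst1 h (br a)) (m + q ^ j * l)
   + - \sum_(i < l) coefX (subst1 f (br a)) (m + q ^ j * (l - i)) *
                    coefX (subst1 g (br a)) i)); last first.
  apply: Pol_modD; first exact: Pol_mod_coef.
  by apply: Pol_modN; apply: Pol_mod_sum => i; apply: IH.
move=> a; apply: cong_subr; have := coef_mul_iter_phi f g j m l a mQ.
(* The last term, i = l, is the desired product. *)
by rewrite big_ord_recr [(l - _)%N]subnn muln0 addn0.
Qed.

End LubinTateSeries.

Theorem theorem4p6 (p : nat) (pr : prime p) (F : fieldExtType (Qp pr))
    (pi : 'o_F) (q : nat)
    (G : fps 2 'o_F) (br : 'o_F -> fps 1 'o_F)
    (hpi : is_unif pi) (hq : residue_card pi q)
    (hLT : lubin_tate pi q G br)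
    (f g : fps 1 'o_F) (hf : psi_ker pi br f) (hg : psi_ker pi br g)
    (m l : nat) (cf cg : {poly F})
    (hcf : is_coef_poly br f m cf) (hcg : is_coef_poly br g l cg) :
  exists P Q : {poly F},
    Pol br (psi_ker pi br) P /\ Int Q /\ cf * cg = P + int_val pi *: Q.
Proof.
have [P [hP e]] := Pol_mod_mul_coef hpi hLT f g m l hf.
have pi0 := int_val_unif_neq0 hpi.
(* The quotient by pi exists over [F]; the congruence at each [a] makes its values integral. *)
exists P, ((int_val pi)^-1 *: (cf * cg - P)); split => //; split; last first.
  by rewrite scalerA divff // scale1r addrC subrK.
move=> a; have [z ez] := e a.
rewrite hornerZ hornerD hornerN hornerM hcf hcg -int_valM ez mulKf //.
exact: valP z.
Qed.
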